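(* Let $A,F,C,D,I,P,Q\in\mathbb R$, $M\ge0$, $K>0$, $\lambda>0$, $\rho>0$, $0<\underline\sigma\le\overline\sigma<\infty$, and let $\alpha_0,\alpha_1\in\mathbb R$, $\alpha_2<0$ be such that the following statement (a) (or equivalently, (b)) holds. (a) The value function of the exploratory LQ problem is $V(x)=\tfrac12\alpha_2x^2+\alpha_1x+\alpha_0+\frac{\lambda}{2\rho}\big(\ln\big(\frac{2\pi e\lambda}{K-\alpha_2D^2\overline\sigma^2}\big)-1\big)$, $x\in\mathbb R$, and the corresponding optimal randomized feedback control is $\boldsymbol\theta^*(u;x)=\mathcal N(u|\mu_3,\sigma_3^2)$ with $\mu_3=\frac{(\alpha_2(F+CD\overline\sigma^2)-I)x+\alpha_1F-Q}{K-\alpha_2D^2\overline\sigma^2}$ and $\sigma_3^2=\frac{\lambda}{K-\alpha_2D^2\overline\sigma^2}$. (b) The value function of the non-exploratory LQ problem is $V^{ne}(x)=\tfrac12\alpha_2x^2+\alpha_1x+\alpha_0$, $x\in\mathbb R$, and the corresponding optimal feedback control is $\boldsymbol u^*(x)=\frac{(\alpha_2(F+CD\overline\sigma^2)-I)x+\alpha_1F-Q}{K-\alpha_2D^2\overline\sigma^2}$. Then the exploration cost of the LQ problem, $$\mathcal C^{u^*,\theta^*}(x)=\big(V^{ne}(x)-V(x)\big)-\lambda\,\mathcal E\Big[\int_0^\infty e^{-\rho t}\Big(\int_{\mathbb R}\theta_t^*(u)\ln\theta_t^*(u)\,du\Big)dt\,\Big|\,X_0^{\theta^*}=x\Big],$$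 where $\theta^*=\{\theta_t^*\}$ is the open-loop control generated by $\boldsymbol\theta^*$ from initial state $x$, is $$\mathcal C^{u^*,\theta^*}(x)=\frac{\lambda}{2\rho},\qquad\forall x\in\mathbb R.$$
   Context: Setting. Work on Peng's $G$-expectation space $(\Omega,\mathcal H,\{\mathcal F_t\}_{t\ge0},\hat{\mathbb E})$ ($\hat{\mathbb E}$ a sublinear expectation, $\hat{\mathbb E}[X]=\sup_{\mathbb P\in\mathcal P}E_{\mathbb P}[X]$ for a family $\mathcal P$ of probability measures), with $B$ a scalar $G$-Brownian motion, $B(1)\sim\mathcal N(0,[\underline\sigma^2,\overline\sigma^2])$. The lower expectation is $\mathcal E[X]=-\hat{\mathbb E}[-X]$. ''q.s.'' (quasi-surely) means outside a set of zero capacity $\sup_{\mathbb P\in\mathcal P}\mathbb P(\cdot)$. The reward is $r(x,u)=-(\frac M2x^2+Ixu+\frac K2u^2+Px+Qu)$, $x,u\in\mathbb R$; actions are unconstrained ($U=\mathbb R$). $\mathcal N(u|\mu,s^2)$ is the Gaussian density. Exploratory LQ problem. For a process $\theta=\{\theta_t\}$ with values in the set $\mathcal P(\mathbb R)$ of probability densities on $\mathbb R$, put $\mu_t=\int u\theta_t(u)du$, $\sigma_t^2=\int u^2\theta_t(u)du-\mu_t^2$, and let $dX_t^\theta=(AX_t^\theta+F\mu_t)dt+\sqrt{(CX_t^\theta+D\mu_t)^2+D^2\sigma_t^2}\,dB_t$, $X_0^\theta=x$, and $g(X_t^\theta,\theta_t)=\int_{\mathbb R}r(X_t^\theta,u)\theta_t(u)du-\lambda\int_{\mathbb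 R}\theta_t(u)\ln\theta_t(u)du$. $\mathcal A(x)$ is the set of $\theta$ with: (i) $\theta_t\in\mathcal P(\mathbb R)$ q.s. for each $t$; (ii) for each Borel $S$, $\{\int_S\theta_t(u)du\}$ is $\mathcal F_t$-progressively measurable; (iii) $\hat{\mathbb E}[\int_0^t(\mu_s^2+\sigma_s^2)ds]<\infty$ for each $t$; (iv) $\liminf_{T\to\infty}e^{-\rho T}\hat{\mathbb E}[(X_T^\theta)^2]=0$; (v) $\hat{\mathbb E}[\int_0^\infty e^{-\rho t}|g(X_t^\theta,\theta_t)|dt]<\infty$. The value function is $V(x)=\sup_{\theta\in\mathcal A(x)}\mathcal E[\int_0^\infty e^{-\rho t}g(X_t^\theta,\theta_t)dt\,|\,X_0^\theta=x]$. Non-exploratory LQ problem. $dx_t^u=(Ax_t^u+Fu_t)dt+(Cx_t^u+Du_t)dB_t$, $x_0^u=x$, with value function $V^{ne}(x)=\sup_{u\in\mathcal A^{ne}(x)}\mathcal E[\int_0^\infty e^{-\rho t}r(x_t^u,u_t)dt\,|\,x_0^u=x]$, where $\mathcal A^{ne}(x)$ is the set of $\{\mathcal F_t\}$-progressively measurable real-valued $u$ with $\hat{\mathbb E}[\int_0^tu_s^2ds]<\infty$ for each $t$, $\liminf_{T\to\infty}e^{-\rho T}\hat{\mathbb E}[(x_T^u)^2]=0$, and $\hat{\mathbb E}[\int_0^\infty e^{-\rho t}|r(x_t^u,u_t)|dt]<\infty$. A feedback control ($\boldsymbol\theta(\cdot;x)$, respectively $\boldsymbol u(x)$) is optimal if,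 for every initial state $x$, the closed-loop state equation (with $\theta_t=\boldsymbol\theta(\cdot;X_t)$, respectively $u_t=\boldsymbol u(x_t)$) has a unique strong solution and the open-loop control so generated is admissible and attains the supremum. The equivalence of (a) and (b) (for the same constants) is a separate result of the paper and may be taken as part of the hypothesis, i.e. both (a) and (b) hold. *)

(* Defs.v *)
From HB Require Import structures.
From mathcomp Require Import all_boot all_order all_algebra.
From mathcomp Require Import all_classical all_reals all_analysis.

Set Implicit Arguments.
Unset Strict Implicit.
Unset Printing Implicit Defensive.

Import Order.TTheory GRing.Theory Num.Theory.
Import numFieldNormedType.Exports.

Local Open Scope classical_set_scope.
Local Open Scope ring_scope.

(* C_0([0, oo)): paths are extended by 0 to negative times, so that equality  *)
(* of elements is equality on [0, oo).                                        *)
Record path0 (R : realType) := Path0 {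
  path_fun :> R -> R ;
  path_continuous : continuous path_fun ;
  path_init : forall t : R, t <= 0 -> path_fun t = 0 }.

HB.instance Definition _ (R : realType) := gen_eqMixin (path0 R).
HB.instance Definition _ (R : realType) := gen_choiceMixin (path0 R).
HB.instance Definition _ (R : realType) := isPointed.Build (path0 R)
  (@Path0 R (fun=> 0) (fun=> cvg_cst _) (fun _ _ => erefl)).

Definition B {R : realType} (t : R) (w : path0 R) : R := w t.

(* {B s \in A} for s in [0, t] and A Borel *)
Definition cylinders {R : realType} (t : \bar R) : set (set (path0 R)) :=
  [set C | exists (s : R) (A : set R),
     [/\ 0 <= s, (s%:E <= t)%E, measurable A & C = B s @^-1` A]].

(* The path space with the sigma-algebra F_t = sigma(B_s, s <= t), resp. with *)
(* sigma(B_s, s >= 0), i.e., the Borel sigma-algebra of C_0([0, oo)).         *)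
Definition Filt {R : realType} (t : \bar R) := g_sigma_algebraType (@cylinders R t).
Definition Omega (R : realType) := @Filt R +oo%E.

(* Joint measurability on [0, t] x Omega for B([0, t]) (x) F_t, t >= 0. *)
Definition progressive {R : realType} (X : R -> Omega R -> R) :=
  forall t : R, 0 <= t ->
    measurable_fun (`[0, t] `*` [set: Filt t%:E])
      (fun p : R * Filt t%:E => X p.1 p.2).

Section SublinearExpectation.
Context {R : realType} (PP : set (probability (Omega R) R)).

Definition Ehat (X : Omega R -> \bar R) : \bar R :=
  ereal_sup [set (\int[P]_w X w)%E | P in PP].

Definition Elow (X : Omega R -> \bar R) : \bar R :=
  (- Ehat (fun w => - X w))%E.

Definition capacity (N : set (Omega R)) : \bar R :=
  ereal_sup [set P N | P in PP].

Definition qs (prop : Omega R -> Prop) :=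
  exists N : set (Omega R),
    [/\ measurable N, capacity N = 0%E & forall w, ~ N w -> prop w].

End SublinearExpectation.

(* The test functions C_{l.Lip}(V): locally Lipschitz of polynomial growth. *)
Definition C_lLip {R : realType} {V : normedModType R} (phi : V -> R) :=
  exists (c : R) (m : nat), forall x y : V,
    `|phi x - phi y| <= c * (1 + `|x| ^+ m + `|y| ^+ m) * `|x - y|.

(* (B_{t_1}, ..., B_{t_n}) *)
Definition Bvec {R : realType} {n : nat} (t : 'I_n -> R) (w : Omega R) : 'rV[R]_n :=
  \row_i B (t i) w.

(* The space H = Lip(Omega) of cylinder random variables. *)
Definition Lip {R : realType} (X : Omega R -> R) :=
  exists (n : nat) (t : 'I_n -> R) (phi : 'rV[R]_n -> R),
    [/\ forall i, 0 <= t i, C_lLip phi & X = phi \o Bvec t].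

Section GBrownianMotion.
Context {R : realType} (PP : set (probability (Omega R) R)).

(* Y is independent from X in the (non-symmetric) sense of Peng:
   E[phi(X, Y)] = E[ E[phi(x, Y)]_{x = X} ]. *)
Definition independent_from {V W : normedModType R}
    (Y : Omega R -> W) (X : Omega R -> V) :=
  forall phi : V * W -> R, C_lLip phi ->
    Ehat PP (fun w => (phi (X w, Y w))%:E) =
    Ehat PP (fun w => Ehat PP (fun w' => (phi (X w, Y w'))%:E)).

(* X ~ N(0, [vl, vu]): a X + b X' and sqrt(a^2 + b^2) X are identically
   distributed for all a, b >= 0, where X' is an independent copy of X.  The copy
   is eliminated: E[phi(a X + b X')] only depends on the distribution of X. *)
Definition G_normal (vl vu : R) (X : Omega R -> R) :=
  [/\ Ehat PP (fun w => (X w ^+ 2)%:E) = vu%:E,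
      Elow PP (fun w => (X w ^+ 2)%:E) = vl%:E
    & forall (a b : R) (phi : R^o -> R), 0 <= a -> 0 <= b -> C_lLip phi ->
        Ehat PP (fun w => Ehat PP (fun w' => (phi (a * X w + b * X w'))%:E)) =
        Ehat PP (fun w => (phi (Num.sqrt (a ^+ 2 + b ^+ 2) * X w))%:E)].

Definition G_Brownian (vl vu : R) :=
  forall t s : R, 0 <= t -> 0 <= s ->
    G_normal (s * vl) (s * vu) (fun w => B (t + s) w - B t w) /\
    forall (n : nat) (ti : 'I_n -> R), (forall i, 0 <= ti i <= t) ->
      independent_from (fun w => (B (t + s) w - B t w : R^o)) (Bvec ti).

(* The family PP represents a (finite) sublinear expectation on Lip(Omega) under
   which the canonical process is a G-Brownian motion, B(1) ~ N(0, [vl, vu]). *)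
Definition G_expectation_space (vl vu : R) :=
  (forall X : Omega R -> R, Lip X -> Ehat PP (fun w => (X w)%:E) \is a fin_num) /\
  G_Brownian vl vu.

End GBrownianMotion.

Record simple_process (R : realType) := SimpleProcess {
  sp_size : nat ;
  sp_time : nat -> R ;
  sp_coef : nat -> Omega R -> R ;
  sp_time0 : 0 <= sp_time 0 ;
  sp_time_nd : forall j, sp_time j <= sp_time j.+1 ;
  sp_bounded : forall j, exists c, forall w, `|sp_coef j w| <= c ;
  sp_adapted : forall j, measurable_fun [set: Filt (sp_time j)%:E]
                 (sp_coef j : Filt (sp_time j)%:E -> R) }.

Definition sp_val {R : realType} (H : simple_process R) (s : R) (w : Omega R) : R :=
  \sum_(j < sp_size H)
     sp_coef H j w * \1_(`[sp_time H j, sp_time H j.+1[%classic) s.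

Definition sp_int {R : realType} (H : simple_process R) (t : R) (w : Omega R) : R :=
  \sum_(j < sp_size H)
     sp_coef H j w * (B (Num.min (sp_time H j.+1) t) w - B (Num.min (sp_time H j) t) w).

Section StateEquation.
Context {R : realType} (PP : set (probability (Omega R) R)).

Definition qs_continuous (X : R -> Omega R -> R) :=
  qs PP (fun w => {within [set t : R | 0 <= t], continuous (X ^~ w)}).

(* Y_t = int_0^t eta_s dB_s quasi-surely: one process Y which under every P in PP
   is the L^2(P)-limit of the integrals of simple processes approximating eta.  On
   Peng's class M_G^2 this is the usual G-Ito integral; it does not require
   quasi-continuity of eta, which is only progressively measurable here. *)
Definition ito_integral (eta Y : R -> Omega R -> R) :=
  [/\ progressive eta, progressive Y, qs_continuous Y
    & forall P, PP P -> forall T : R, 0 < T ->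
        exists H : nat -> simple_process R,
          (\int[P]_w \int[lebesgue_measure]_(s in `[0%R, T])
              ((sp_val (H n) s w - eta s w) ^+ 2)%:E)%E @[n --> \oo] --> 0%E /\
          forall t : R, 0 <= t <= T ->
            (\int[P]_w ((sp_int (H n) t w - Y t w) ^+ 2)%:E)%E
              @[n --> \oo] --> 0%E].

(* dX_t = b_t dt + eta_t dB_t, X_0 = x *)
Definition ito_process (x : R) (b eta X : R -> Omega R -> R) :=
  [/\ progressive X, qs_continuous X
    & exists2 Y, ito_integral eta Y
      & qs PP (fun w => forall t : R, 0 <= t ->
          lebesgue_measure.-integrable `[0, t] (fun s => (b s w)%:E) /\
          X t w = x + \int[lebesgue_measure]_(s in `[0, t]) b s w + Y t w)].

Definition indistinguishable (X X' : R -> Omega R -> R) :=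
  qs PP (fun w => forall t : R, 0 <= t -> X t w = X' t w).

End StateEquation.

Record lq_model (R : realType) := LQModel {
  lqA : R ; lqF : R ; lqC : R ; lqD : R ;
  lqM : R ; lqI : R ; lqK : R ; lqP : R ; lqQ : R ;
  lqrho : R }.

Section LQ.
Context {R : realType} (PP : set (probability (Omega R) R)) (L : lq_model R).

Local Notation A := (lqA L).
Local Notation F := (lqF L).
Local Notation C := (lqC L).
Local Notation D := (lqD L).
Local Notation rho := (lqrho L).
Local Notation leb := (@lebesgue_measure R).

Definition reward (x u : R) : R :=
  - (lqM L / 2 * x ^+ 2 + lqI L * x * u + lqK L / 2 * u ^+ 2 + lqP L * x + lqQ L * u).

Definition discounted (f : R -> \bar R) : \bar R :=
  (\int[leb]_(t in `[0%R, +oo[) ((expR (- (rho * t)))%:E * f t))%E.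

(* liminf_{T -> oo} e^{- rho T} E[X_T^2] = 0 *)
Definition transversality (X : R -> Omega R -> R) :=
  limf_einf (fun T : R =>
    ((expR (- (rho * T)))%:E * Ehat PP (fun w => (X T w ^+ 2)%:E))%E) +oo%R = 0%E.

Section NonExploratory.

Definition state_ne (x : R) (u X : R -> Omega R -> R) :=
  ito_process PP x (fun t w => A * X t w + F * u t w)
    (fun t w => C * X t w + D * u t w) X.

Definition admissible_ne (x : R) (u X : R -> Omega R -> R) :=
  [/\ state_ne x u X,
      progressive u,
      forall t : R, 0 <= t ->
        (Ehat PP (fun w => \int[leb]_(s in `[0%R, t]) (u s w ^+ 2)%:E) < +oo)%E,
      transversality X
    & (Ehat PP (fun w => discounted (fun t => `|(reward (X t w) (u t w))%:E|))
         < +oo)%E].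

Definition payoff_ne (u X : R -> Omega R -> R) : \bar R :=
  Elow PP (fun w => discounted (fun t => (reward (X t w) (u t w))%:E)).

Definition value_ne (x : R) : \bar R :=
  ereal_sup [set y | exists u X, admissible_ne x u X /\ y = payoff_ne u X].

Definition closed_loop_ne (ufb : R -> R) (x : R) (X : R -> Omega R -> R) :=
  state_ne x (fun t w => ufb (X t w)) X.

Definition optimal_ne (ufb : R -> R) :=
  forall x : R, exists X : R -> Omega R -> R,
    [/\ closed_loop_ne ufb x X,
        forall X', closed_loop_ne ufb x X' -> indistinguishable PP X X',
        admissible_ne x (fun t w => ufb (X t w)) X
      & payoff_ne (fun t w => ufb (X t w)) X = value_ne x].

End NonExploratory.

Section Exploratory.
Variable lambda : R.

Definition is_density (f : R -> R) :=
  [/\ measurable_fun [set: R] f, forall u, 0 <= f u & (\int[leb]_u (f u)%:E = 1)%E].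

Definition density_mean (f : R -> R) : R := \int[leb]_u (u * f u).

(* +oo for a density without second moment *)
Definition density_variance (f : R -> R) : \bar R :=
  (\int[leb]_u (u ^+ 2 * f u)%:E - (density_mean f ^+ 2)%:E)%E.

(* int f ln f; since ln 0 = 0 in the library, the integrand is 0 where f is *)
Definition neg_entropy (f : R -> R) : \bar R := (\int[leb]_u (f u * ln (f u))%:E)%E.

Definition gain (x : R) (f : R -> R) : \bar R :=
  (\int[leb]_u (reward x u * f u)%:E - lambda%:E * neg_entropy f)%E.

(* By admissibility the variance is finite for almost every time, q.s., hence
   its real part determines the stochastic integral. *)
Definition state (x : R) (theta : R -> Omega R -> R -> R) (X : R -> Omega R -> R) :=
  ito_process PP x (fun t w => A * X t w + F * density_mean (theta t w))
    (fun t w => Num.sqrt ((C * X t w + D * density_mean (theta t w)) ^+ 2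
                          + D ^+ 2 * fine (density_variance (theta t w)))) X.

Definition admissible (x : R) (theta : R -> Omega R -> R -> R)
    (X : R -> Omega R -> R) :=
  state x theta X /\
  [/\ forall t : R, 0 <= t -> qs PP (fun w => is_density (theta t w)),
      forall S : set R, measurable S ->
        progressive (fun t w => \int[leb]_(u in S) theta t w u),
      forall t : R, 0 <= t ->
        (Ehat PP (fun w => \int[leb]_(s in `[0%R, t])
           ((density_mean (theta s w) ^+ 2)%:E + density_variance (theta s w))) < +oo)%E,
      transversality X
    & (Ehat PP (fun w => discounted (fun t => `|gain (X t w) (theta t w)|)) < +oo)%E].

Definition payoff (theta : R -> Omega R -> R -> R) (X : R -> Omega R -> R) : \bar R :=
  Elow PP (fun w => discounted (fun t => gain (X t w) (theta t w))).

Definition value (x : R) : \bar R :=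
  ereal_sup [set y | exists theta X, admissible x theta X /\ y = payoff theta X].

(* Theta x is the density of the randomized feedback control at state x. *)
Definition closed_loop (Theta : R -> R -> R) (x : R) (X : R -> Omega R -> R) :=
  state x (fun t w => Theta (X t w)) X.

Definition optimal (Theta : R -> R -> R) :=
  forall x : R, exists X : R -> Omega R -> R,
    [/\ closed_loop Theta x X,
        forall X', closed_loop Theta x X' -> indistinguishable PP X X',
        admissible x (fun t w => Theta (X t w)) X
      & payoff (fun t w => Theta (X t w)) X = value x].

Definition exploration_cost (theta : R -> Omega R -> R -> R) (x : R) : \bar R :=
  ((value_ne x - value x)
   - lambda%:E * Elow PP (fun w => discounted (fun t => neg_entropy (theta t w))))%E.

End Exploratory.
End LQ.

(* Main.v *)
Require Import Defs.
From mathcomp Require Import all_boot all_order all_algebra.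
From mathcomp Require Import all_classical all_reals all_analysis.
From mathcomp Require Import measurable_realfun ring.

(* The differential entropy of N(m, s^2) is ln(2 pi e s^2) / 2, whatever m.  Along
   the optimal randomized control the variance is the constant lambda / den, so
   the entropy term is a deterministic constant: discounting divides it by rho
   and the lower expectation leaves it unchanged.  In the exploration cost its
   logarithm cancels the one in V^ne - V, and lambda / (2 rho) remains.  The
   entropy of the normal density rests on the second moment of the Gaussian. *)

Set Implicit Arguments.
Unset Strict Implicit.
Unset Printing Implicit Defensive.

Import Order.TTheory GRing.Theory Num.Theory.
Import numFieldNormedType.Exports.

Local Open Scope classical_set_scope.
Local Open Scope ring_scope.

Section GaussSecondMoment.
Context {R : realType}.
Import gauss_integral_proof.
Local Notation leb := (@lebesgue_measure R).

(** The square of this integral is known to tend to [pi / 4]. The integral is nonnegative, hence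
    equal to the root of its square, and the root is continuous. *)
Lemma cvg_integral0_gauss : @integral0_gauss R x @[x --> +oo] --> Num.sqrt pi / 2.
Proof.
have -> : Num.sqrt pi / 2 = Num.sqrt (pi / 4) :> R.
  rewrite sqrtrM ?pi_ge0// sqrtrV// (_ : 4 = 2 ^+ 2 :> R); last by rewrite -natrX.
  by rewrite sqrtr_sqr ger0_norm.
have -> : @integral0_gauss R = fun x => Num.sqrt (integral0_gauss x ^+ 2).
  by apply/funext => x; rewrite sqrtr_sqr ger0_norm// integral0_gauss_ge0.
by apply: continuous_cvg;
  [exact: sqrt_continuous | exact: cvg_integral0_gauss_sqr].
Qed.

(** Squeezed between 0 and [x^-1], because [expR (x ^+ 2) >= 1 + x ^+ 2 >= x ^+ 2]. *)
Lemma cvg_mul_gauss : x * gauss_fun x @[x --> +oo] --> (0 : R).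
Proof.
apply: (@squeeze_cvgr _ _ _ _ (cst 0) (fun x : R => x^-1)).
- near=> x.
  have x0 : 0 < x by near: x; exact: nbhs_pinfty_gt.
  rewrite mulr_ge0 ?gauss_fun_ge0 ?(ltW x0)//=.
  rewrite /gauss_fun expRN ler_pdivrMr ?expR_gt0//.
  rewrite ler_pdivlMl// -expr2.
  by apply: le_trans (expR_ge1Dx _); rewrite lerDr.
- exact: cvg_cst.
- apply/gtr0_cvgV0; last exact: cvg_id.
  by near=> x; near: x; exact: nbhs_pinfty_gt.
Unshelve. all: end_near. Qed.

Lemma is_derive_gauss (x : R) : is_derive x 1 gauss_fun (- (2 * x) * gauss_fun x).
Proof.
by apply: is_derive_eq; rewrite /gauss_fun /GRing.scale /=; ring.
Qed.

Lemma derive_integral0_gauss (x : R) : 0 < x ->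
  is_derive x 1 (@integral0_gauss R) (gauss_fun x).
Proof.
move=> x0.
(* The upper end [x + 1] makes [x] an interior point of the interval. *)
have [//||//||dI I'] := @continuous_FTC1_closed R gauss_fun 0 x (x + 1).
- by rewrite ltrDl.
- apply: continuous_compact_integrable; first exact: segment_compact.
  exact/continuous_subspaceT/continuous_gauss_fun.
- exact: continuous_gauss_fun.
- by rewrite -I' derive1E; exact: derivableP.
Qed.

Lemma integral0y_sqr_gauss :
  (\int[leb]_(x in `[0%R, +oo[) (x ^+ 2 * gauss_fun x)%:E)%E
    = (Num.sqrt pi / 4)%:E.
Proof.
have cg : continuous (@gauss_fun R) by exact: continuous_gauss_fun.
(* [F' = x ^+ 2 * gauss_fun x], by integration by parts. *)
pose F (x : R) := 2^-1 * (integral0_gauss x - x * gauss_fun x).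
have dF (x : R) : 0 < x -> is_derive x 1 F (x ^+ 2 * gauss_fun x).
  move=> x0.
  have dI := derive_integral0_gauss x0.
  have dg := is_derive_gauss x.
  by apply: is_derive_eq; rewrite /GRing.scale /=; field.
(* Left unsimplified so that the limit at 0 can be taken factor by factor. *)
have F0 : F 0 = 2^-1 * (0 - 0 * gauss_fun 0).
  by rewrite /F /integral0_gauss set_itv1 Rintegral_set1.
transitivity ((Num.sqrt pi / 4)%:E - (F 0)%:E)%E;
  first apply: ge0_continuous_FTC2y.
- by move=> x _; rewrite mulr_ge0 ?sqr_ge0 ?gauss_fun_ge0.
- apply: continuous_subspaceT => x.
  by apply: cvgM; [exact: exprn_continuous | exact: cg].
- rewrite (_ : Num.sqrt pi / 4 = 2^-1 * (Num.sqrt pi / 2 - 0)); last by field.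
  apply: cvgM; first exact: cvg_cst.
  by apply: cvgB; [exact: cvg_integral0_gauss | exact: cvg_mul_gauss].
- by move=> x x0; have [] := dF x x0.
(* [dF] covers only [x > 0], so continuity of [F] at the endpoint 0 is checked directly. *)
- rewrite F0; apply: cvg_at_right_filter; apply: cvgM; first exact: cvg_cst.
  apply: cvgB.
    apply: (@parameterized_integral_cvg_left _ 0 1) => //.
    apply: continuous_compact_integrable; first exact: segment_compact.
    exact/continuous_subspaceT.
  by apply: cvgM; [exact: cvg_id | exact: cg].
- move=> x; rewrite in_itv/= andbT => x0.
  by rewrite derive1E; have [] := dF x x0.
by rewrite F0 mul0r subrr mulr0 sube0.
Qed.

Lemma integralT_sqr_gauss :
  (\int[leb]_x (x ^+ 2 * gauss_fun x)%:E)%E = (Num.sqrt pi / 2)%:E.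
Proof.
rewrite ge0_symfun_integralT.
- by rewrite -set_itvcy integral0y_sqr_gauss -EFinM; congr EFin; field.
- by move=> x; rewrite mulr_ge0 ?sqr_ge0 ?gauss_fun_ge0.
- move=> x; apply: cvgM; first exact: exprn_continuous.
  exact: continuous_gauss_fun.
- by move=> x /=; rewrite /gauss_fun sqrrN.
Qed.

End GaussSecondMoment.

(** Substitution along the increasing bijection [phi], whose derivative is the constant [s^-1]; the
    factor [s] compensates for it. *)
Lemma ge0_integralT_affine {R : realType} (m s : R) (G : R -> R) : 0 < s ->
  continuous G -> (forall x, 0 <= G x) ->
  (\int[lebesgue_measure]_x (G ((x - m) / s))%:E =
   s%:E * \int[lebesgue_measure]_x (G x)%:E)%E.
Proof.
move=> s0 cG G0; pose phi (x : R) := (x - m) / s.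
have dphi (x : R) : is_derive x 1 phi s^-1.
  by apply: is_derive_eq; rewrite /GRing.scale /=; ring.
have phi'E : phi^`()%classic = cst s^-1.
  by apply/funext => x; rewrite derive1E; have [] := dphi x.
have s'0 : 0 < s^-1 by rewrite invr_gt0.
rewrite (@increasing_ge0_integration_by_substitutionT _ phi G) //.
- rewrite phi'E -ge0_integralZl//=.
  + by apply: eq_integral => x _; rewrite -EFinM mulrCA divff ?mulr1 ?gt_eqF.
  + apply/measurable_EFinP; apply: measurable_funM => //.
    apply: measurableT_comp; first exact: continuous_measurable_fun.
    by apply: measurable_funM => //; exact: measurable_funB.
  + by move=> x _; rewrite lee_fin mulr_ge0 ?(ltW s'0) ?G0.
  + by rewrite lee_fin ltW.
- by move=> x y xy; rewrite ltr_pM2r// ltrD2r.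
- by rewrite phi'E => ?; exact: cvg_cst.
- by rewrite phi'E; exact: is_cvg_cst.
- by rewrite phi'E; exact: is_cvg_cst.
- by apply/gt0_cvgMlNy; last exact: cvg_addrr_Ny.
- by apply/gt0_cvgMly; last exact: cvg_addrr.
Qed.

(** In the variable [y = (x - m) / c] the density [f] is [peak * gauss_fun y], so
    [ln f = ln peak - y ^+ 2]. Integrating against [f] gives [ln peak - 1 / 2], the [1 / 2] being
    the second moment. *)
Lemma neg_entropy_normal {R : realType} (m s : R) : 0 < s ->
  neg_entropy (normal_pdf m s) = (- (ln (2 * pi * expR 1 * s ^+ 2) / 2))%:E.
Proof.
move=> s0; set peak := normal_peak s; pose f := normal_pdf m s.
have sn0 : s != 0 by rewrite gt_eqF.
have peak0 : 0 < peak by exact: normal_peak_gt0.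
have pi0 := pi_gt0 R.
(* This scale turns the exponent [- (x - m) ^+ 2 / (2 * s ^+ 2)] into [- y ^+ 2]. *)
pose c : R := s * Num.sqrt 2.
have c0 : 0 < c by rewrite mulr_gt0// sqrtr_gt0.
have c2 : c ^+ 2 = s ^+ 2 * 2 by rewrite exprMn sqr_sqrtr.
have fE x : f x = peak * gauss_fun ((x - m) / c).
  rewrite /f normal_pdfE// /normal_fun /gauss_fun exprMn exprVn c2 mulr_natr.
  by rewrite mulNr.
pose q (x : R) := peak * (((x - m) / c) ^+ 2 * gauss_fun ((x - m) / c)).
have lnfE x : f x * ln (f x) = ln peak * f x - q x.
  by rewrite {2}fE lnM ?posrE ?expR_gt0// expRK /q fE; ring.
have q0 x : 0 <= q x.
  by rewrite /q mulr_ge0 ?(ltW peak0)// mulr_ge0 ?gauss_fun_ge0 ?sqr_ge0.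
have cG : continuous (fun y : R => peak * (y ^+ 2 * gauss_fun y)).
  move=> x; apply: cvgM; first exact: cvg_cst.
  by apply: cvgM; [exact: exprn_continuous | exact: continuous_gauss_fun].
have Iq : (\int[lebesgue_measure]_x (q x)%:E = (2^-1)%:E)%E.
  rewrite (@ge0_integralT_affine _ m c (fun y => peak * (y ^+ 2 * gauss_fun y)))//;
    last by move=> x; rewrite mulr_ge0 ?(ltW peak0)// mulr_ge0 ?gauss_fun_ge0 ?sqr_ge0.
  under eq_integral do rewrite EFinM.
  rewrite ge0_integralZl//=; last 3 first.
  - apply/measurable_EFinP; apply: measurable_funM => //.
    exact: measurable_gauss_fun.
  - by move=> x _; rewrite lee_fin mulr_ge0 ?gauss_fun_ge0 ?sqr_ge0.
  - by rewrite lee_fin ltW.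
  rewrite integralT_sqr_gauss -!EFinM /peak /normal_peak; congr EFin.
  (* Thus [peak] is the inverse of [c * Num.sqrt pi], which cancels the Jacobian [c] and the root of
     [pi] in the second moment. *)
  have -> : Num.sqrt (s ^+ 2 * pi *+ 2) = c * Num.sqrt pi.
    have -> : s ^+ 2 * pi *+ 2 = c ^+ 2 * pi by rewrite c2 -mulr_natr mulrAC.
    by rewrite sqrtrM ?sqr_ge0// sqrtr_sqr gtr0_norm.
  by field; rewrite !gt_eqF// sqrtr_gt0.
have mq : measurable_fun setT q.
  have -> : q = fun x => (((x - m) / c) ^+ 2 * f x).
    by apply/funext => x; rewrite /q fE mulrCA.
  apply: measurable_funM; last exact: measurable_normal_pdf.
  by apply: measurable_funX; apply: measurable_funM => //; exact: measurable_funB.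
(* [f * ln f] may change sign, so its integral is split by linearity, which needs both terms
   integrable. *)
have iq : lebesgue_measure.-integrable setT (EFin \o q).
  apply/integrableP; split; first exact/measurable_EFinP.
  under eq_integral do rewrite /= ger0_norm//.
  by rewrite Iq ltry.
have iplf : lebesgue_measure.-integrable setT (EFin \o (fun x => ln peak * f x)).
  by have := integrableZl measurableT (ln peak) (integrable_normal_pdf m s).
rewrite /neg_entropy.
under eq_integral do rewrite lnfE EFinB.
rewrite integralB_EFin//.
under eq_integral do rewrite EFinM.
rewrite integralZl//; last exact: integrable_normal_pdf.
rewrite integral_normal_pdf Iq mule1 -EFinB; congr EFin.
pose v : R := s ^+ 2 * pi *+ 2.
have v0 : 0 < v by rewrite mulrn_wgt0// mulr_gt0// exprn_gt0.
have lnv : ln v = 2 * ln (Num.sqrt v).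
  by rewrite -{1}(sqr_sqrtr (ltW v0)) lnXn ?sqrtr_gt0// mulr_natl.
rewrite /peak /normal_peak -/v lnV ?posrE ?sqrtr_gt0//.
(* The factor [expR 1] contributes 1 to the logarithm and so absorbs the [1 / 2] coming from [q]. *)
have -> : 2 * pi * expR 1 * s ^+ 2 = v * expR 1 by rewrite /v -mulr_natr; ring.
by rewrite lnM ?posrE ?expR_gt0// expRK lnv; field.
Qed.

(** The discount factor is [1 / rho] times the exponential density of rate [rho], which has mass
    1. *)
Lemma discounted_cst {R : realType} (L : lq_model R) (c : R) : 0 < lqrho L ->
  discounted L (fun=> c%:E) = (c / lqrho L)%:E.
Proof.
move=> rho0.
have irho : lebesgue_measure.-integrable setT (EFin \o exponential_pdf (lqrho L)).
  exact: integrable_exponential_pdf.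
rewrite /discounted integral_mkcond.
transitivity (\int[lebesgue_measure]_t
    ((c / lqrho L)%:E * (exponential_pdf (lqrho L) t)%:E))%E.
  apply: eq_integral => t _; rewrite /exponential_pdf !patchE.
  case: ifP => _; last by rewrite mule0.
  by rewrite -!EFinM mulNr; congr EFin; field; rewrite gt_eqF.
by rewrite integralZl// integral_exponential_pdf// mule1.
Qed.

(** Each member of [PP] has mass 1, so the supremum is over the singleton of [c]; over an empty
    family it would be [-oo]. *)
Lemma Ehat_cst {R : realType} (PP : set (probability (Omega R) R)) (c : \bar R) :
  PP !=set0 -> Ehat PP (fun=> c) = c.
Proof.
move=> [P0 PP0]; rewrite /Ehat (_ : [set _ | _ in PP] = [set c]) ?ereal_sup1//.
have Pc (P : probability (Omega R) R) : (\int[P]_w c = c)%E.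
  by rewrite integral_cst// -[RHS]mule1; congr (_ * _)%E; exact: probability_setT.
apply/seteqP; split => [_ [P _ <-]|_ ->]; first exact: Pc.
by exists P0 => //; exact: Pc.
Qed.

Lemma Elow_cst {R : realType} (PP : set (probability (Omega R) R)) (c : \bar R) :
  PP !=set0 -> Elow PP (fun=> c) = c.
Proof. by move=> PP0; rewrite /Elow Ehat_cst// oppeK. Qed.

(** The second moment of [B 1 - B 0] is finite, whereas a supremum over an empty family is [-oo]. *)
Lemma G_expectation_space_neq0 {R : realType} (PP : set (probability (Omega R) R))
    (vl vu : R) : G_expectation_space PP vl vu -> PP !=set0.
Proof.
move=> [_ /(_ 0 1 (lexx _) ler01) [[E2 _ _] _]].
apply/set0P/negP => /eqP PP0.
by move: E2; rewrite /Ehat PP0 image_set0 ereal_sup0.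
Qed.

Theorem proposition3 (R : realType) (A F C D I P Q M K lambda rho ls us : R)
    (PP : set (probability (Omega R) R)) (a0 a1 a2 : R) :
  0 <= M -> 0 < K -> 0 < lambda -> 0 < rho -> 0 < ls -> ls <= us ->
  G_expectation_space PP (ls ^+ 2) (us ^+ 2) ->
  a2 < 0 ->
  let L := LQModel A F C D M I K P Q rho in
  let den := K - a2 * D ^+ 2 * us ^+ 2 in
  let mu3 x := ((a2 * (F + C * D * us ^+ 2) - I) * x + a1 * F - Q) / den in
  let s3 := lambda / den in
  let Theta x u := normal_pdf (mu3 x) (Num.sqrt s3) u in
  (forall x : R, value PP L lambda x =
     (a2 / 2 * x ^+ 2 + a1 * x + a0
      + lambda / (2 * rho) * (ln (2 * pi * expR 1 * lambda / den) - 1))%:E) ->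
  optimal PP L lambda Theta ->
  (forall x : R, value_ne PP L x = (a2 / 2 * x ^+ 2 + a1 * x + a0)%:E) ->
  optimal_ne PP L mu3 ->
  forall (x : R) (X : R -> Omega R -> R),
    closed_loop PP L Theta x X ->
    exploration_cost PP L lambda (fun t w => Theta (X t w)) x
      = (lambda / (2 * rho))%:E.
Proof.
move=> _ K0 lambda0 rho0 _ _ /G_expectation_space_neq0 PP0 a20 L den mu3 s3 Theta
  Vx _ Vnex _ x X _.
(* Since [a2 < 0], [den] is at least [K]. *)
have den0 : 0 < den.
  by rewrite subr_gt0 (le_lt_trans _ K0)// -mulrA nmulr_rle0// mulr_ge0 ?sqr_ge0.
have s30 : 0 < s3 by rewrite divr_gt0.
have entropy t w : neg_entropy (Theta (X t w))
    = (- (ln (2 * pi * expR 1 * lambda / den) / 2))%:E.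
  by rewrite neg_entropy_normal ?sqrtr_gt0// sqr_sqrtr ?ltW// /s3 mulrA.
rewrite /exploration_cost Vx Vnex.
(* The integrand no longer depends on [t], on [w] or on the state process [X]. *)
under eq_fun do under eq_fun do rewrite entropy.
rewrite discounted_cst// Elow_cst// -EFinM -!EFinB; congr EFin => /=.
(* With [l] the logarithm, the value gap is [- lambda / (2 * rho) * (l - 1)] and the entropy term
   adds [lambda * l / (2 * rho)]. *)
by field; rewrite gt_eqF.
Qed.
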